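(* Let $Q$ be a polyhedral partially ordered abelian group and $k$ a field. Every downset-finite $Q$-module admits a primary decomposition.
   Context: An abelian group $Q$ is partially ordered if it is generated by a submonoid $Q_+$ (the positive cone) with trivial unit group; the order is $q\preceq q'\iff q'-q\in Q_+$. A face of $Q_+$ is a submonoid $\sigma\subseteq Q_+$ such that $Q_+\setminus\sigma$ is an ideal of the monoid $Q_+$. $Q$ is polyhedral if it has only finitely many faces. A $Q$-module is a $Q$-graded $k$-vector space $M=\bigoplus_{q\in Q}M_q$ with linear structure maps $M_q\to M_{q'}$ for $q\preceq q'$, compatible with composition; equivalently, a $Q$-graded module over the monoid algebra $k[Q_+]$. Homomorphisms are degree-preserving and commute with structure maps. For a downset $D\subseteq Q$ (subset closed under going down), the downset module $k[D]$ is the quotient of $k[Q]=\bigoplus_{q\in Q}k$ (identity structure maps) that is $k$ in degrees from $D$ and $0$ elsewhere. $M$ is downset-finite if there is an injection $M\hookrightarrow\bigoplus_{j\in J}E_j$ with $J$ finite and each $E_j$ a downset module. The localization of $M$ along a face $\tau$ is $M_\tau=M\otimes_{k[Q_+]}k[Q_++\mathbb{Z}\tau]$, where $\mathbb{Z}\tau\subseteq Q$ is the subgroup generated by $\tau$. The submodule of $M$ globally supported on $\tau$ is $\Gamma_\tau M=\bigcap_{\tau'\not\subseteq\tau}\ker(M\to M_{\tau'})$, the intersection over faces $\tau'\not\subseteq\tau$. The module $M$ is coprimary if for some face $\tau$ the localization map $M\to M_\tau$ is injective and $\Gamma_\tau(M_\tau)$ is an essential submodule of $M_\tau$ (meets every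 nonzero submodule of $M_\tau$ nontrivially). A primary decomposition of $M$ is an injection $M\hookrightarrow\bigoplus_{i=1}^r M/M_i$ (induced by the quotient maps) into a finite direct sum of coprimary quotients $M/M_i$ of $M$. *)

(* Defs.v *)
From HB Require Import structures.
From mathcomp Require Import all_boot all_order all_algebra.
From mathcomp Require Import generic_quotient ring_quotient.
From mathcomp Require Import boolp classical_sets cardinality.

Set Implicit Arguments.
Unset Strict Implicit.
Unset Printing Implicit Defensive.

Import GRing.Theory.
Local Open Scope classical_set_scope.
Local Open Scope quotient_scope.
Local Open Scope ring_scope.

Definition is_submonoid (G : zmodType) (A : set G) : Prop :=
  A 0 /\ forall x y, A x -> A y -> A (x + y).

Definition is_subgroup (G : zmodType) (A : set G) : Prop :=
  A 0 /\ forall x y, A x -> A y -> A (x - y).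

Definition zspan (G : zmodType) (A : set G) : set G := smallest (@is_subgroup G) A.

Record poabGroup := POAbGroup {
  poab_sort :> zmodType;
  poscone : set poab_sort;
  poscone_submonoid : is_submonoid poscone;
  poscone_units : forall x, poscone x -> poscone (- x) -> x = 0;
  poscone_gen : zspan poscone = setT }.

Definition pole (Q : poabGroup) (q q' : Q) : Prop := poscone (q' - q).
Notation "q ⪯ q'" := (pole q q') (at level 70, no associativity).

Section Order.
Variable Q : poabGroup.

Definition is_ideal (I : set Q) : Prop :=
  I `<=` @poscone Q /\ forall x y, I x -> poscone y -> I (x + y).

Definition is_face (s : set Q) : Prop :=
  [/\ is_submonoid s, s `<=` @poscone Q & is_ideal (@poscone Q `\` s)].

Definition polyhedral : Prop := finite_set [set s : set Q | is_face s].

Definition upset (U : set Q) : Prop := forall q q', q ⪯ q' -> U q -> U q'.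
Definition downset (D : set Q) : Prop := forall q q', q ⪯ q' -> D q' -> D q.

Lemma downsetC D : downset D -> upset (~` D).
Proof. by move=> hD q q' le_qq' nDq Dq'; apply: nDq; apply: hD Dq'. Qed.

(* Q_+ + Z t *)
Definition loccone (t : set Q) : set Q :=
  [set q | exists a z, [/\ poscone a, zspan t z & q = a + z]].

Lemma pole_refl (q : Q) : q ⪯ q.
Proof. by rewrite /pole subrr; case: (poscone_submonoid Q). Qed.

Lemma pole_trans (q q' q'' : Q) : q ⪯ q' -> q' ⪯ q'' -> q ⪯ q''.
Proof.
rewrite /pole => h h'; rewrite -(subrKA q' q'').
by case: (poscone_submonoid Q) => _; apply.
Qed.

Lemma pole_shift (a q q' : Q) : q ⪯ q' -> a ⪯ a + (q' - q).
Proof. by rewrite /pole [a + _]addrC addrK. Qed.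

Lemma loccone0 t : loccone t 0.
Proof.
exists 0, 0; split; last by rewrite addr0.
- by case: (poscone_submonoid Q).
- by move=> A [[A0 _] _].
Qed.

Lemma loccone_upset t : upset (loccone t).
Proof.
move=> q q' le_qq' [a [z [pa tz e]]].
exists (q' - q + a), z; split=> //; last by rewrite -addrA -e subrK.
by case: (poscone_submonoid Q) => _; apply.
Qed.

End Order.

(* A Q-graded vector space with a linear map [str h] for every proof
   [h : q ⪯ q']; [qstr_id] and [qstr_comp] quantify over all such proofs, so
   [str h] does not depend on [h]. *)
Record qmod (k : fieldType) (Q : poabGroup) := QMod {
  qdeg :> Q -> lmodType k;
  qstr : forall q q', q ⪯ q' -> {linear qdeg q -> qdeg q'};
  qstr_id : forall q (h : q ⪯ q) x, qstr h x = x;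
  qstr_comp : forall q q' q'' (h : q ⪯ q') (h' : q' ⪯ q'') (h'' : q ⪯ q'') x,
    qstr h' (qstr h x) = qstr h'' x }.
Arguments qstr {k Q} M {q q'} h : rename.

Record qhom (k : fieldType) (Q : poabGroup) (M N : qmod k Q) := QHom {
  qhom_fun :> forall q, {linear M q -> N q};
  qhom_str : forall q q' (h : q ⪯ q') x,
    qhom_fun q' (qstr M h x) = qstr N h (qhom_fun q x) }.

Definition qinjective (k : fieldType) (Q : poabGroup) (M N : qmod k Q)
  (f : qhom M N) : Prop := forall q, injective (f q).

Record submod (k : fieldType) (Q : poabGroup) (M : qmod k Q) := Submod {
  sdeg :> forall q, submodClosed (M q);
  sstr : forall q q' (h : q ⪯ q') x, x \in sdeg q -> qstr M h x \in sdeg q' }.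

Definition lin (k : fieldType) (U V : lmodType k) (f : U -> V) (hf : linear f) :
  {linear U -> V} := HB.pack_for {linear U -> V} f (GRing.isLinear.Build k U V _ f hf).

Section SubspaceModule.
Variables (k : fieldType) (V : lmodType k) (S : submodClosed V).

Record subspace := Subspace { subspace_val : V; _ : subspace_val \in S }.
HB.instance Definition _ := [isSub for subspace_val].
HB.instance Definition _ := [Choice of subspace by <:].
HB.instance Definition _ := [SubChoice_isSubLmodule of subspace by <:].

End SubspaceModule.

Section SubmodAsModule.
Variables (k : fieldType) (Q : poabGroup) (M : qmod k Q) (S : submod M).

Definition sub_str q q' (h : q ⪯ q') (x : subspace (S q)) : subspace (S q') :=
  Subspace (sstr h (valP x)).

Lemma sub_str_linear q q' (h : q ⪯ q') : linear (sub_str h).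
Proof. by move=> a x y; apply: val_inj; rewrite /= !linearP. Qed.

Lemma sub_str_id q (h : q ⪯ q) x : lin (sub_str_linear h) x = x.
Proof. by apply: val_inj; rewrite /= qstr_id. Qed.

Lemma sub_str_comp q q' q'' (h : q ⪯ q') (h' : q' ⪯ q'') (h'' : q ⪯ q'') x :
  lin (sub_str_linear h') (lin (sub_str_linear h) x) = lin (sub_str_linear h'') x.
Proof. by apply: val_inj; rewrite /= (qstr_comp _ _ h''). Qed.

Definition submod_mod : qmod k Q := QMod sub_str_id sub_str_comp.

End SubmodAsModule.

Section QuotientSpace.
Variables (k : fieldType) (V : lmodType k) (S : submodClosed V).

(* [submodClosed] does not inherit from [zmodClosed] in MathComp. *)
Definition quot_pred : {pred V} := S.
HB.instance Definition _ :=
  GRing.isZmodClosed.Build V quot_pred (GRing.submod_closedB (submodClosedP S)).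

Definition quotspace := Quotient.quot quot_pred.
HB.instance Definition _ := GRing.Zmodule.on quotspace.
HB.instance Definition _ := EqQuotient.on quotspace.

Definition qpi (x : V) : quotspace := \pi_(Quotient.quot quot_pred) x.
Definition qrep (x : quotspace) : V := repr (x : Quotient.quot quot_pred).
Definition qscale (a : k) (x : quotspace) : quotspace := qpi (a *: qrep x).

Lemma qrepK x : qpi (qrep x) = x. Proof. exact: reprK. Qed.

Lemma qpiP (x y : V) : reflect (qpi x = qpi y) (x - y \in S).
Proof. by rewrite (Quotient.idealrBE quot_pred); apply: eqP. Qed.

Lemma qpiD (x y : V) : qpi (x + y) = qpi x + qpi y.
Proof. exact: (@Quotient.pi_add _ quot_pred). Qed.

Lemma qpiZ a (x : V) : qpi (a *: x) = qscale a (qpi x).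
Proof. by apply/qpiP; rewrite -scalerBr rpredZ //; apply/qpiP; rewrite qrepK. Qed.

Lemma qscaleA a b x : qscale a (qscale b x) = qscale (a * b) x.
Proof. by rewrite -[x]qrepK -!qpiZ scalerA. Qed.
Lemma qscale1 : left_id 1 qscale.
Proof. by move=> x; rewrite -[x]qrepK -qpiZ scale1r. Qed.
Lemma qscaleDr : right_distributive qscale +%R.
Proof.
by move=> a x y; rewrite -[x]qrepK -[y]qrepK -qpiD -!qpiZ scalerDr qpiD.
Qed.
Lemma qscaleDl x : {morph qscale^~ x : a b / a + b}.
Proof. by move=> a b; rewrite -[x]qrepK -!qpiZ scalerDl qpiD. Qed.

HB.instance Definition _ :=
  GRing.Zmodule_isLmodule.Build k quotspace qscaleA qscale1 qscaleDr qscaleDl.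

Lemma qpi_linear : linear qpi.
Proof. by move=> a x y; rewrite qpiD qpiZ. Qed.

End QuotientSpace.

Section QuotientModule.
Variables (k : fieldType) (Q : poabGroup) (M : qmod k Q) (S : submod M).

Definition quot_str q q' (h : q ⪯ q') (x : quotspace (S q)) : quotspace (S q') :=
  qpi (S q') (qstr M h (qrep x)).

Lemma quot_strE q q' (h : q ⪯ q') (x : M q) :
  quot_str h (qpi (S q) x) = qpi (S q') (qstr M h x).
Proof.
by apply/qpiP; rewrite -linearB sstr //; apply/qpiP; rewrite qrepK.
Qed.

Lemma quot_str_linear q q' (h : q ⪯ q') : linear (quot_str h).
Proof.
move=> a x y; rewrite -[x]qrepK -[y]qrepK.
by rewrite -qpi_linear !quot_strE linearP qpi_linear.
Qed.

Lemma quot_str_id q (h : q ⪯ q) x : lin (quot_str_linear h) x = x.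
Proof. by rewrite /= -[x]qrepK quot_strE qstr_id. Qed.

Lemma quot_str_comp q q' q'' (h : q ⪯ q') (h' : q' ⪯ q'') (h'' : q ⪯ q'') x :
  lin (quot_str_linear h') (lin (quot_str_linear h) x) = lin (quot_str_linear h'') x.
Proof. by rewrite /= -[x]qrepK !quot_strE (qstr_comp _ _ h''). Qed.

Definition quot_mod : qmod k Q := QMod quot_str_id quot_str_comp.

Lemma quot_proj_str q q' (h : q ⪯ q') (x : M q) :
  lin (@qpi_linear k _ (S q')) (qstr M h x) =
  qstr quot_mod h (lin (@qpi_linear k _ (S q)) x).
Proof. by rewrite /= quot_strE. Qed.

Definition quot_proj : qhom M quot_mod :=
  @QHom k Q M quot_mod (fun q => lin (@qpi_linear k _ (S q))) quot_proj_str.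

End QuotientModule.

(* The index set is finite, so the direct sum is carried by all families. *)
Section DirectSumSpace.
Variables (k : fieldType) (J : finType) (V : J -> lmodType k).

Definition dsumspace : Type := forall j, V j.
HB.instance Definition _ := gen_eqMixin dsumspace.
HB.instance Definition _ := gen_choiceMixin dsumspace.
Implicit Types x y z : dsumspace.

Definition dsum0 : dsumspace := fun j => 0.
Definition dsumN x : dsumspace := fun j => - x j.
Definition dsumD x y : dsumspace := fun j => x j + y j.
Definition dsumZ (a : k) x : dsumspace := fun j => a *: x j.

Lemma dsumDA : associative dsumD.
Proof. by move=> x y z; apply: functional_extensionality_dep => j; exact: addrA. Qed.
Lemma dsumDC : commutative dsumD.
Proof. by move=> x y; apply: functional_extensionality_dep => j; exact: addrC. Qed.
Lemma dsum0D : left_id dsum0 dsumD.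
Proof. by move=> x; apply: functional_extensionality_dep => j; exact: add0r. Qed.
Lemma dsumND : left_inverse dsum0 dsumN dsumD.
Proof. by move=> x; apply: functional_extensionality_dep => j; exact: addNr. Qed.
HB.instance Definition _ :=
  GRing.isZmodule.Build dsumspace dsumDA dsumDC dsum0D dsumND.

Lemma dsumZA a b x : dsumZ a (dsumZ b x) = dsumZ (a * b) x.
Proof. by apply: functional_extensionality_dep => j; exact: scalerA. Qed.
Lemma dsum1Z : left_id 1 dsumZ.
Proof. by move=> x; apply: functional_extensionality_dep => j; exact: scale1r. Qed.
Lemma dsumZDr : right_distributive dsumZ +%R.
Proof. by move=> a x y; apply: functional_extensionality_dep => j; exact: scalerDr. Qed.
Lemma dsumZDl x : {morph dsumZ^~ x : a b / a + b}.
Proof. by move=> a b; apply: functional_extensionality_dep => j; exact: scalerDl. Qed.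
HB.instance Definition _ :=
  GRing.Zmodule_isLmodule.Build k dsumspace dsumZA dsum1Z dsumZDr dsumZDl.

End DirectSumSpace.

Section DirectSum.
Variables (k : fieldType) (Q : poabGroup) (J : finType) (E : J -> qmod k Q).

Local Notation dspace q := (dsumspace (fun j => E j q)).

Definition dsum_str q q' (h : q ⪯ q') (x : dspace q) : dspace q' :=
  fun j => qstr (E j) h (x j).

Lemma dsum_str_linear q q' (h : q ⪯ q') : linear (dsum_str h).
Proof. by move=> a x y; apply: functional_extensionality_dep => j; exact: linearP. Qed.

Lemma dsum_str_id q (h : q ⪯ q) x : lin (dsum_str_linear h) x = x.
Proof. by apply: functional_extensionality_dep => j; exact: qstr_id. Qed.

Lemma dsum_str_comp q q' q'' (h : q ⪯ q') (h' : q' ⪯ q'') (h'' : q ⪯ q'') x :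
  lin (dsum_str_linear h') (lin (dsum_str_linear h) x) = lin (dsum_str_linear h'') x.
Proof. by apply: functional_extensionality_dep => j; exact: qstr_comp. Qed.

Definition dsum_mod : qmod k Q :=
  @QMod k Q (fun q => dspace q) _ dsum_str_id dsum_str_comp.

Variables (M : qmod k Q) (f : forall j, qhom M (E j)).

Definition dsum_map q (x : M q) : dspace q := fun j => f j q x.

Lemma dsum_map_linear q : linear (@dsum_map q).
Proof. by move=> a x y; apply: functional_extensionality_dep => j; exact: linearP. Qed.

Lemma dsum_map_str q q' (h : q ⪯ q') (x : M q) :
  lin (@dsum_map_linear q') (qstr M h x) = qstr dsum_mod h (lin (@dsum_map_linear q) x).
Proof. by apply: functional_extensionality_dep => j; exact: qhom_str. Qed.

Definition dsum_hom : qhom M dsum_mod :=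
  @QHom k Q M dsum_mod (fun q => lin (@dsum_map_linear q)) dsum_map_str.

End DirectSum.

Section IndicatorModules.
Variables (k : fieldType) (Q : poabGroup).

Definition kQ_str (q q' : Q) (h : q ⪯ q') : {linear k^o -> k^o} := idfun.

Definition kQ : qmod k Q :=
  @QMod k Q (fun _ => k^o) kQ_str (fun q h x => erefl) (fun q q' q'' h h' h'' x => erefl).

(* The submodule of k[Q] equal to k in the degrees of an upset U, 0 elsewhere. *)
Definition indicator (U : set Q) (q : Q) : {pred kQ q} :=
  fun x => `[< U q >] || (x == 0).

Lemma indicator_closed U q : submod_closed (@indicator U q).
Proof.
split=> [|a x y]; rewrite !unfold_in /indicator ?eqxx ?orbT //.
by case: asboolP => //= _ /eqP -> /eqP ->; rewrite scaler0 addr0.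
Qed.

HB.instance Definition _ U q :=
  GRing.isSubmodClosed.Build k (kQ q) (@indicator U q) 
    (GRing.submod_closed_semi (@indicator_closed U q)).

Lemma indicator_str U (hU : upset U) q q' (h : q ⪯ q') (x : kQ q) :
  x \in @indicator U q -> qstr kQ h x \in @indicator U q'.
Proof.
rewrite !unfold_in /indicator => /orP[/asboolP Uq|/eqP ->]; last by rewrite eqxx orbT.
by apply/orP; left; apply/asboolP; apply: hU Uq.
Qed.

Definition upset_submod U (hU : upset U) : submod kQ :=
  @Submod k Q kQ (fun q => @indicator U q) (@indicator_str U hU).

(* k[D] as the quotient of k[Q] by the part in degrees outside D. *)
Definition downset_mod D (hD : downset D) : qmod k Q :=
  quot_mod (upset_submod (downsetC hD)).

End IndicatorModules.

Definition downset_finite (k : fieldType) (Q : poabGroup) (M : qmod k Q) : Prop :=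
  exists (J : finType) (D : J -> set Q) (hD : forall j, downset (D j))
    (f : qhom M (dsum_mod (fun j => downset_mod k (hD j)))), qinjective f.

Section TensorSpace.
Variables (k : fieldType) (Q : poabGroup) (M N : qmod k Q) (q : Q).

(* A pure tensor of homogeneous elements, of total degree q. *)
Record ptensor := PTensor {
  pt_ldeg : Q; pt_rdeg : Q;
  pt_left : M pt_ldeg; pt_right : N pt_rdeg;
  pt_deg : pt_ldeg + pt_rdeg = q }.
HB.instance Definition _ := gen_eqMixin ptensor.
HB.instance Definition _ := gen_choiceMixin ptensor.

(* The congruence on formal sums of pure tensors presenting the degree q part
   of the tensor product over k[Q_+].  [tens_bal] moves the monomial of degree
   a' - a = b' - b across the tensor sign. *)
Inductive tens_eq : seq ptensor -> seq ptensor -> Prop :=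
| tens_refl s : tens_eq s s
| tens_sym s t : tens_eq s t -> tens_eq t s
| tens_trans s t u : tens_eq s t -> tens_eq t u -> tens_eq s u
| tens_cat s s' t t' : tens_eq s s' -> tens_eq t t' -> tens_eq (s ++ t) (s' ++ t')
| tens_comm s t : tens_eq (s ++ t) (t ++ s)
| tens_zero a b (e : a + b = q) (n : N b) :
    tens_eq [:: PTensor (0 : M a) n e] [::]
| tens_addl a b (e : a + b = q) (m m' : M a) (n : N b) :
    tens_eq [:: PTensor (m + m') n e] [:: PTensor m n e; PTensor m' n e]
| tens_addr a b (e : a + b = q) (m : M a) (n n' : N b) :
    tens_eq [:: PTensor m (n + n') e] [:: PTensor m n e; PTensor m n' e]
| tens_scale a b (e : a + b = q) (c : k) (m : M a) (n : N b) :
    tens_eq [:: PTensor (c *: m) n e] [:: PTensor m (c *: n) e]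
| tens_bal a a' b b' (h : a ⪯ a') (h' : b ⪯ b')
    (e : a' + b = q) (e' : a + b' = q) (m : M a) (n : N b) :
    tens_eq [:: PTensor (qstr M h m) n e] [:: PTensor m (qstr N h' n) e'].

Lemma tens_equiv : equiv_class_of (fun s t => `[< tens_eq s t >]).
Proof.
split=> [s|s t|t s u].
- by apply/asboolP; exact: tens_refl.
- by apply: asbool_equiv_eq; split; exact: tens_sym.
- by move=> /asboolP st /asboolP tu; apply/asboolP; apply: tens_trans st tu.
Qed.
Canonical tens_equivRel := EquivRelPack tens_equiv.
Canonical tens_encModRel := defaultEncModRel (fun s t => `[< tens_eq s t >]).

Definition tensquot := {eq_quot tens_equivRel}.
Definition tensspace : Type := tensquot.
HB.instance Definition _ := Choice.copy tensspace tensquot.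

Definition tpi (s : seq ptensor) : tensspace := \pi_tensquot s.
Definition trep (x : tensspace) : seq ptensor := repr (x : tensquot).

Lemma trepK x : tpi (trep x) = x. Proof. exact: reprK. Qed.

Lemma tpiP s t : tpi s = tpi t <-> tens_eq s t.
Proof.
by split=> [/eqmodP/asboolP|st]; last apply/eqmodP/asboolP.
Qed.

Lemma trep_pi s : tens_eq (trep (tpi s)) s.
Proof. by apply/tpiP; rewrite trepK. Qed.

Definition pt_scale (c : k) (t : ptensor) : ptensor :=
  PTensor (c *: pt_left t) (pt_right t) (pt_deg t).

Definition tens0 : tensspace := tpi [::].
Definition tensD (x y : tensspace) : tensspace := tpi (trep x ++ trep y).
Definition tensZ (c : k) (x : tensspace) : tensspace := tpi (map (pt_scale c) (trep x)).
Definition tensN (x : tensspace) : tensspace := tensZ (-1) x.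

Lemma tens_eq_scale c s t :
  tens_eq s t -> tens_eq (map (pt_scale c) s) (map (pt_scale c) t).
Proof.
elim=> {s t} [s|s t _|s t u _ st _ tu|s s' t t' _ IHs _ IHt|s t|a b e n|a b e m m' n
  |a b e m n n'|a b e d m n|a a' b b' h h' e e' m n].
- exact: tens_refl.
- exact: tens_sym.
- exact: tens_trans st tu.
- by rewrite !map_cat; exact: tens_cat.
- by rewrite !map_cat; exact: tens_comm.
- by rewrite /= /pt_scale /= scaler0; exact: tens_zero.
- by rewrite /= /pt_scale /= scalerDr; exact: tens_addl.
- exact: tens_addr.
- by rewrite /= /pt_scale /= scalerA mulrC -scalerA; exact: tens_scale.
- by rewrite /= /pt_scale /= -linearZ; exact: tens_bal.
Qed.

Lemma tpiD s t : tpi (s ++ t) = tensD (tpi s) (tpi t).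
Proof. by apply/tpiP; apply: tens_cat; apply: tens_sym; exact: trep_pi. Qed.

Lemma tpiZ c s : tpi (map (pt_scale c) s) = tensZ c (tpi s).
Proof. by apply/tpiP; apply: tens_eq_scale; apply: tens_sym; exact: trep_pi. Qed.

Lemma tpi_ind (P : tensspace -> Prop) : (forall s, P (tpi s)) -> forall x, P x.
Proof. by move=> Ps x; rewrite -(trepK x). Qed.

Lemma tpi_consD t s : tpi (t :: s) = tensD (tpi [:: t]) (tpi s).
Proof. by rewrite -tpiD. Qed.

Lemma tensDA : associative tensD.
Proof.
elim/tpi_ind=> s; elim/tpi_ind=> t; elim/tpi_ind=> u.
by rewrite -!tpiD catA.
Qed.
Lemma tensDC : commutative tensD.
Proof.
elim/tpi_ind=> s; elim/tpi_ind=> t.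
by rewrite -!tpiD; apply/tpiP; exact: tens_comm.
Qed.
Lemma tens0D : left_id tens0 tensD.
Proof. by elim/tpi_ind=> s; rewrite -tpiD. Qed.

Lemma tens_scaleDl c d s :
  tens_eq (map (pt_scale (c + d)) s) (map (pt_scale c) s ++ map (pt_scale d) s).
Proof.
apply/tpiP; elim: s => //= t s IHs.
rewrite tpi_consD IHs (tpi_consD (pt_scale c t)) !tpiD.
rewrite (tpi_consD (pt_scale d t)).
have -> : tpi [:: pt_scale (c + d) t] =
          tensD (tpi [:: pt_scale c t]) (tpi [:: pt_scale d t]).
  by rewrite -tpiD; apply/tpiP; rewrite /pt_scale scalerDl; exact: tens_addl.
rewrite -!tensDA; congr (tensD _ _).
by rewrite !tensDA [tensD (tpi [:: pt_scale d t]) _]tensDC.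
Qed.

Lemma tens_scale0 s : tpi (map (pt_scale 0) s) = tens0.
Proof.
elim: s => //= t s IHs; rewrite tpi_consD IHs tensDC tens0D.
by apply/tpiP; rewrite /pt_scale scale0r; exact: tens_zero.
Qed.

Lemma pt_scale1 t : pt_scale 1 t = t.
Proof. by case: t => a b m n e; rewrite /pt_scale /= scale1r. Qed.

Lemma tensZA c d x : tensZ c (tensZ d x) = tensZ (c * d) x.
Proof.
elim/tpi_ind: x => s; rewrite -!tpiZ -map_comp; congr tpi.
by apply: eq_map => t; rewrite /pt_scale /= scalerA.
Qed.
Lemma tens1Z : left_id 1 tensZ.
Proof. by elim/tpi_ind=> s; rewrite -tpiZ (eq_map pt_scale1) map_id. Qed.
Lemma tensZDr c : {morph tensZ c : x y / tensD x y}.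
Proof.
by elim/tpi_ind=> s; elim/tpi_ind=> t; rewrite -tpiD -!tpiZ map_cat tpiD.
Qed.
Lemma tensZDl x c d : tensZ (c + d) x = tensD (tensZ c x) (tensZ d x).
Proof. by elim/tpi_ind: x => s; rewrite -!tpiZ -tpiD; apply/tpiP; exact: tens_scaleDl. Qed.
Lemma tensND : left_inverse tens0 tensN tensD.
Proof.
move=> x; rewrite -{2}(tens1Z x) -tensZDl addNr.
by elim/tpi_ind: x => s; rewrite -tpiZ tens_scale0.
Qed.

HB.instance Definition _ :=
  GRing.isZmodule.Build tensspace tensDA tensDC tens0D tensND.
HB.instance Definition _ :=
  GRing.Zmodule_isLmodule.Build k tensspace tensZA tens1Z tensZDr tensZDl.

Lemma tpi_catE s t : tpi (s ++ t) = tpi s + tpi t. Proof. exact: tpiD. Qed.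
Lemma tpi_scaleE c s : tpi (map (pt_scale c) s) = c *: tpi s. Proof. exact: tpiZ. Qed.

End TensorSpace.

Section TensorModule.
Variables (k : fieldType) (Q : poabGroup) (M N : qmod k Q).

Lemma ptensor_str_deg (q q' a b : Q) : a + b = q -> a + (q' - q) + b = q'.
Proof. by move=> <-; rewrite addrAC addrC subrK. Qed.

Definition pt_str q q' (h : q ⪯ q') (t : ptensor M N q) : ptensor M N q' :=
  PTensor (qstr M (pole_shift _ h) (pt_left t)) (pt_right t)
          (ptensor_str_deg q' (pt_deg t)).

Definition tens_str q q' (h : q ⪯ q') (x : tensspace M N q) : tensspace M N q' :=
  tpi (map (pt_str h) (trep x)).

Lemma pt_eq_left q a a' b (h : a ⪯ a') (e : a' + b = q) (e' : a + b = q)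
  (m : M a) (n : N b) :
  PTensor (qstr M h m) n e = PTensor m n e'.
Proof.
have aa' : a = a' by apply: (addIr b); rewrite e e'.
case: _ / aa' in h e *; rewrite qstr_id; congr PTensor; exact: Prop_irrelevance.
Qed.

Lemma tens_eq_str q q' (h : q ⪯ q') (s t : seq (ptensor M N q)) :
  tens_eq s t -> tens_eq (map (pt_str h) s) (map (pt_str h) t).
Proof.
elim=> {s t} [s|s t _|s t u _ st _ tu|s s' t t' _ IHs _ IHt|s t|a b e n|a b e m m' n
  |a b e m n n'|a b e d m n|a a' b b' ha hb e e' m n].
- exact: tens_refl.
- exact: tens_sym.
- exact: tens_trans st tu.
- by rewrite !map_cat; exact: tens_cat.
- by rewrite !map_cat; exact: tens_comm.
- by rewrite /= /pt_str /= linear0; exact: tens_zero.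
- by rewrite /= /pt_str /= linearD; exact: tens_addl.
- exact: tens_addr.
- by rewrite /= /pt_str /= linearZ; exact: tens_scale.
- have hc : a + (q' - q) ⪯ a' + (q' - q).
    by move: ha; rewrite /pole opprD addrACA subrr addr0.
  have hd : a ⪯ a' + (q' - q) := pole_trans ha (pole_shift a' h).
  rewrite /= /pt_str /= (qstr_comp _ _ hd) -(qstr_comp (pole_shift a h) hc).
  exact: tens_bal.
Qed.

Lemma tens_strE q q' (h : q ⪯ q') s : tens_str h (tpi s) = tpi (map (pt_str h) s).
Proof. by apply/tpiP; apply: tens_eq_str; exact: trep_pi. Qed.

Lemma tens_str_linear q q' (h : q ⪯ q') : linear (tens_str h).
Proof.
move=> c; elim/tpi_ind=> s; elim/tpi_ind=> t.
rewrite -tpi_scaleE -tpi_catE !tens_strE map_cat tpi_catE -tpi_scaleE.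
congr (tpi _ + _); rewrite -!map_comp; apply: eq_map => u.
by rewrite /= /pt_str /pt_scale /= linearZ.
Qed.

Lemma tens_str_id q (h : q ⪯ q) x : lin (tens_str_linear h) x = x.
Proof.
elim/tpi_ind: x => s; rewrite /= tens_strE; congr tpi.
rewrite -[RHS]map_id; apply: eq_map => -[a b m n e].
exact: pt_eq_left.
Qed.

Lemma tens_str_comp q q' q'' (h : q ⪯ q') (h' : q' ⪯ q'') (h'' : q ⪯ q'') x :
  lin (tens_str_linear h') (lin (tens_str_linear h) x) = lin (tens_str_linear h'') x.
Proof.
elim/tpi_ind: x => s; rewrite /= !tens_strE -map_comp; congr tpi.
apply: eq_map => -[a b m n e]; rewrite /= /pt_str /=.
have e0 : a + (q' - q) + (q'' - q') = a + (q'' - q).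
  by rewrite -addrA [q' - q + _]addrC subrKA.
have h3 : a ⪯ a + (q' - q) + (q'' - q') by rewrite e0; exact: pole_shift.
have h4 : a + (q'' - q) ⪯ a + (q' - q) + (q'' - q').
  by rewrite e0; exact: pole_refl.
rewrite (qstr_comp _ _ h3) -(qstr_comp (pole_shift a h'') h4).
exact: pt_eq_left.
Qed.

Definition tensor_mod : qmod k Q :=
  @QMod k Q (fun q => tensspace M N q) _ tens_str_id tens_str_comp.

End TensorModule.

Section Localization.
Variables (k : fieldType) (Q : poabGroup) (t : set Q).

(* k[Q_+ + Z t], inside k[Q]. *)
Definition kloc : qmod k Q := submod_mod (upset_submod k (@loccone_upset Q t)).

Lemma kloc1_subproof : (1 : kQ k Q 0) \in upset_submod k (@loccone_upset Q t) 0.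
Proof. by apply/orP; left; apply/asboolP; exact: loccone0. Qed.

Definition kloc1 : kloc 0 := Subspace kloc1_subproof.

Definition localization (M : qmod k Q) : qmod k Q := tensor_mod M kloc.

Variable M : qmod k Q.

Definition loc_map q (x : M q) : localization M q :=
  tpi [:: PTensor x kloc1 (addr0 q)].

Lemma loc_map_linear q : linear (@loc_map q).
Proof.
move=> c x y; rewrite /loc_map -tpi_scaleE -tpi_catE.
by apply/tpiP; exact: tens_addl.
Qed.

Lemma loc_map_str q q' (h : q ⪯ q') (x : M q) :
  lin (@loc_map_linear q') (qstr M h x) =
  qstr (localization M) h (lin (@loc_map_linear q) x).
Proof.
rewrite /= /loc_map tens_strE /= /pt_str /=; congr (tpi [:: _]).
have e : q + (q' - q) = q' by rewrite addrC subrK.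
have h' : q + (q' - q) ⪯ q' by rewrite e; exact: pole_refl.
by rewrite -(qstr_comp (pole_shift q h) h' h); apply: pt_eq_left.
Qed.

Definition loc_hom : qhom M (localization M) :=
  @QHom k Q M (localization M) (fun q => lin (@loc_map_linear q)) loc_map_str.

End Localization.

Section Support.
Variables (k : fieldType) (Q : poabGroup) (t : set Q) (M : qmod k Q).

(* [supported x] says that x lies in Gamma_t M. *)
Definition supported q (x : M q) : Prop :=
  forall t' : set Q, is_face t' -> ~ (t' `<=` t) -> loc_hom t' M q x = 0.

Definition supp_pred q : {pred M q} := fun x => `[< supported x >].

Lemma supp_closed q : submod_closed (@supp_pred q).
Proof.
split=> [|a x y].
  by apply/asboolP => t' _ _; exact: linear0.
move=> /asboolP sx /asboolP sy; apply/asboolP => t' ft' nt'.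
by rewrite linearP sx // sy // scaler0 addr0.
Qed.

HB.instance Definition _ q :=
  GRing.isSubmodClosed.Build k (M q) (@supp_pred q)
    (GRing.submod_closed_semi (@supp_closed q)).

Lemma supp_str q q' (h : q ⪯ q') (x : M q) :
  x \in @supp_pred q -> qstr M h x \in @supp_pred q'.
Proof.
move=> /asboolP sx; apply/asboolP => t' ft' nt'.
by rewrite qhom_str sx // linear0.
Qed.

Definition supp_submod : submod M := @Submod k Q M (fun q => @supp_pred q) supp_str.

End Support.

Definition nonzero_submod (k : fieldType) (Q : poabGroup) (M : qmod k Q)
  (S : submod M) : Prop := exists q (x : M q), x \in S q /\ x <> 0.

Definition essential (k : fieldType) (Q : poabGroup) (M : qmod k Q)
  (S : submod M) : Prop :=
  forall N : submod M, nonzero_submod N ->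
    exists q (x : M q), [/\ x \in N q, x \in S q & x <> 0].

Definition coprimary (k : fieldType) (Q : poabGroup) (M : qmod k Q) : Prop :=
  exists t : set Q, [/\ is_face t, qinjective (loc_hom t M) &
    essential (supp_submod t (localization t M))].

Definition primary_decomposition (k : fieldType) (Q : poabGroup) (M : qmod k Q)
  (r : nat) (S : 'I_r -> submod M) : Prop :=
  (forall i, coprimary (quot_mod (S i))) /\
  qinjective (dsum_hom (fun i => quot_proj (S i))).

(* Main.v *)
From HB Require Import structures.
Require Import Defs.
From mathcomp Require Import all_boot all_order all_algebra.
From mathcomp Require Import boolp classical_sets cardinality.

(** The problem reduces to downsets.  For a downset [D] and a face [t], call
[g] locally supported on [t] when the translate [g + t] stays inside [D], but
[g + t + s] leaves [D] for every face [s] not contained in [t]; let [P_t] be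
the downset generated by these [g].  Every [q] in [D] lies in some [P_t]: since
there are finitely many faces, one can choose [t] maximal with [q + t] inside
[D], and then [q] itself is locally supported on [t], because a violating face
[s] could be joined to [t] to give a larger face ([coprimary_part_cover]).  So
[k[D]] embeds in the direct sum of its quotients [k[P_t]].

Given an embedding of [M] in a finite direct sum of modules [k[D_j]], the
kernels of the maps from [M] to [k[P_t(D_j)]], for all [j] and [t], therefore
have zero intersection.  It remains to see that each quotient [N] by such a
kernel, a submodule of some [k[P_t]], is coprimary ([component_coprimary]).
By [coprimary_criterion] two elementary properties suffice: multiplication by
[t] is injective on [N], as [P_t] is stable under translation by [t]; and every
nonzero element, of degree [q] say, has a nonzero multiple of degree some
locally supported [g] above [q], which each face [s] not contained in [t]
pushes out of [P_t] ([local_support_exit]).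

The criterion rests on two facts about the tensor product that defines a
localization along [t].  Every element is a fraction, that is a pure tensor
[m (x) x^b] with [- b] in [t] ([localization_fraction]); and an element of [N]
dies in the localization exactly when some element of [t] kills it
([loc_map_eq0]).  The first gives, for each nonzero submodule of the
localization, a nonzero element coming from [N]; the second shows that the
multiple supplied by the criterion stays nonzero and is supported on [t]. *)

Set Implicit Arguments.
Unset Strict Implicit.
Unset Printing Implicit Defensive.

Import GRing.Theory.
Local Open Scope classical_set_scope.
Local Open Scope ring_scope.

(** * The positive cone and its faces *)

Section Cone.
Variable Q : poabGroup.
Implicit Types (q x y : Q) (t s D : set Q).

Lemma poscone0 : @poscone Q 0.
Proof. by case: (poscone_submonoid Q). Qed.

Lemma posconeD x y : poscone x -> poscone y -> poscone (x + y).
Proof. by case: (poscone_submonoid Q) => _; apply. Qed.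

Lemma zspan_submonoid t z : is_submonoid t -> zspan t z ->
  exists x y, [/\ t x, t y & z = x - y].
Proof.
move=> [t0 tD] /(_ [set z | exists x y, [/\ t x, t y & z = x - y]]); apply.
split; last by move=> x tx; exists x, 0; split; rewrite ?subr0.
split; first by exists 0, 0; split; rewrite ?subrr.
move=> _ _ [x [y [tx ty ->]]] [x' [y' [tx' ty' ->]]].
exists (x + y'), (y + x'); split; [exact: tD|exact: tD|].
by rewrite opprB opprD addrACA.
Qed.

Lemma zspanN t x : t x -> zspan t (- x).
Proof.
move=> tx A [[A0 AB] tA]; rewrite -[- x]add0r; apply: AB => //; exact: tA.
Qed.

Lemma locconeN t x : t x -> loccone t (- x).
Proof. by move=> tx; exists 0, (- x); split; [exact: poscone0|exact: zspanN|rewrite add0r]. Qed.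

(** The least face containing both [t] and [s]: the elements of the cone lying
below some element of [t + s]. *)
Definition face_join t s : set Q :=
  [set x | poscone x /\ exists y a b, [/\ poscone y, t a, s b & x + y = a + b]].

Lemma face_join_face t s : is_face t -> is_face s -> is_face (face_join t s).
Proof.
move=> [[t0 tD] tQ _] [[s0 sD] sQ _]; split.
- split.
    split; first exact: poscone0.
    by exists 0, 0, 0; split; rewrite ?addr0 //; exact: poscone0.
  move=> x x' [px [y [a [b [py ta sb e]]]]] [px' [y' [a' [b' [py' ta' sb' e']]]]].
  split; first exact: posconeD.
  exists (y + y'), (a + a'), (b + b'); split.
  + exact: posconeD.
  + exact: tD.
  + exact: sD.
  + by rewrite addrACA e e' addrACA.
- by move=> x [].
- split=> [x []//|x y [px nx] py]; split; first exact: posconeD.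
  move=> [_ [z [a [b [pz ta sb e]]]]]; apply: nx; split=> //.
  by exists (y + z), a, b; split=> //; [exact: posconeD|rewrite addrA].
Qed.

Lemma face_join_subl t s : is_face t -> is_face s -> t `<=` face_join t s.
Proof.
move=> [_ tQ _] [[s0 _] _ _] x tx; split; first exact: tQ.
by exists 0, x, 0; split=> //; exact: poscone0.
Qed.

Lemma face_join_subr t s : is_face t -> is_face s -> s `<=` face_join t s.
Proof.
move=> [[t0 _] _ _] [_ sQ _] x sx; split; first exact: sQ.
by exists 0, 0, x; split=> //; [exact: poscone0|rewrite addrC].
Qed.

(** This is where triviality of the unit group of the cone is used; it provides
the starting point for choosing a maximal face. *)
Lemma face0 : is_face [set 0 : Q].
Proof.
split.
- by split=> // x y -> ->; rewrite /= addr0.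
- by move=> _ ->; exact: poscone0.
- split=> [x []//|x y [px nx] py]; split; first exact: posconeD.
  move=> /= xy0; apply: nx => /=; apply: poscone_units => //.
  suff -> : - x = y by [].
  by rewrite -[LHS]addr0 -xy0 addKr.
Qed.

End Cone.

(** * Fractions in a localization *)

Section Fractions.
Variables (k : fieldType) (Q : poabGroup) (N : qmod k Q) (t : set Q).

Lemma kloc_unit_subproof b : loccone t b ->
  (1 : kQ k Q b) \in upset_submod k (@loccone_upset Q t) b.
Proof. by move=> hb; apply/orP; left; apply/asboolP. Qed.

Definition kloc_unit b (hb : loccone t b) : kloc k t b :=
  Subspace (kloc_unit_subproof hb).

Definition fraction q a b (m : N a) (hb : loccone t b) (e : a + b = q) :
  localization t N q := tpi [:: PTensor m (kloc_unit hb) e].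

(** The unit of [kloc] and [kloc_unit h0] carry different membership proofs, so
this equality needs proof irrelevance. *)
Lemma loc_map_fraction q (x : N q) (h0 : loccone t 0) :
  loc_map t x = fraction x h0 (addr0 q).
Proof. by rewrite /fraction; congr (tpi [:: PTensor _ _ _]); apply: val_inj. Qed.

Lemma fraction0 q a b (hb : loccone t b) (e : a + b = q) :
  fraction (0 : N a) hb e = 0.
Proof. by apply/tpiP; exact: tens_zero. Qed.

Lemma fractionD q a b (m m' : N a) (hb : loccone t b) (e : a + b = q) :
  fraction (m + m') hb e = fraction m hb e + fraction m' hb e.
Proof. by rewrite -tpi_catE; apply/tpiP; exact: tens_addl. Qed.

(** Multiplying numerator and denominator by the monomial of degree [a' - a]:
the balancing relation of the tensor product, read on fractions. *)
Lemma fraction_expand q a a' b b' (h : a ⪯ a') (m : N a)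
    (hb : loccone t b) (hb' : loccone t b') (e : a + b = q) (e' : a' + b' = q) :
  fraction (qstr N h m) hb' e' = fraction m hb e.
Proof.
have h' : b' ⪯ b.
  suff -> : (b' ⪯ b) = (a ⪯ a') by [].
  by rewrite /pole; congr poscone; apply/eqP; rewrite subr_eq addrAC -subr_eq opprK
    [b + a]addrC e -e' .
rewrite /fraction.
have -> : kloc_unit hb = qstr (kloc k t) h' (kloc_unit hb') by apply: val_inj.
by apply/tpiP; exact: tens_bal.
Qed.

Hypotheses (tM : is_submonoid t) (tQ : t `<=` @poscone Q).

(** A degree of [loccone t] has the form [c + x - y] with [c] in the cone and
[x], [y] in [t], so the monomial in the right factor is [c + x] times the
inverse of [y]; the first factor moves across the tensor sign.  In the other
degrees the right factor vanishes. *)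
Lemma pure_tensor_fraction q (u : ptensor N (kloc k t) q) :
  exists a b (e : a + b = q) (hb : loccone t b) (m : N a),
    t (- b) /\ tpi [:: u] = fraction m hb e.
Proof.
case: u => a b m n e.
have [hb|nb] := pselect (loccone t b).
  have [c [z [pc /(zspan_submonoid tM)[x [y [tx ty ez]]] eb]]] := hb.
  have ea : q + y + - y = q by rewrite addrK.
  have h : a ⪯ q + y.
    have : poscone (c + x) by apply: posconeD => //; exact: tQ.
    by rewrite /pole -e {1}eb ez [a + (c + _)]addrC addrAC addrK -addrA subrK.
  exists (q + y), (- y), ea, (locconeN ty),
    (qstr N h ((subspace_val n : k) *: m)).
  rewrite opprK; split=> //.
  rewrite (fraction_expand _ _ hb _ e) /fraction.
  have en : n = (subspace_val n : k) *: kloc_unit hb.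
    by apply: val_inj; rewrite /= /GRing.scale /= mulr1.
  rewrite {1}en.
  by apply/esym/tpiP; exact: tens_scale.
have -> : n = 0 :> kloc k t b.
  apply: val_inj => /=; case: n => n /= /orP[/asboolP//|/eqP //].
exists q, 0, (addr0 q), (loccone0 t), 0; split; first by rewrite oppr0; case: tM.
rewrite fraction0 -(scale0r (0 : kloc k t b)).
apply/tpiP; apply: tens_trans (tens_sym (tens_scale _ _ _ _)) _.
by rewrite scale0r; exact: tens_zero.
Qed.

(** Two fractions are added over the common denominator [b + b']. *)
Lemma localization_fraction q (z : localization t N q) :
  exists a b (e : a + b = q) (hb : loccone t b) (m : N a),
    t (- b) /\ z = fraction m hb e.
Proof.
elim/tpi_ind: z; elim=> [|u s [a' [b' [e' [hb' [m' [tb' ez']]]]]]].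
  exists q, 0, (addr0 q), (loccone0 t), 0; split; last by rewrite fraction0.
  by rewrite oppr0; case: tM.
rewrite -cat1s tpi_catE ez'.
have [a [b [e [hb [m [tb ->]]]]]] := pure_tensor_fraction u.
have tbb : t (- (b + b')) by rewrite opprD; apply: tM.2.
have hbb : loccone t (b + b') by rewrite -[b + b']opprK; exact: locconeN.
have ec : q - (b + b') + (b + b') = q by rewrite subrK.
have h : a ⪯ q - (b + b').
  by rewrite /pole opprD addrA -{1}e addrK [a - b']addrC addrK; exact: tQ.
have h' : a' ⪯ q - (b + b').
  by rewrite /pole [b + b']addrC opprD addrA -{1}e' addrK [a' - b]addrC addrK; exact: tQ.
exists (q - (b + b')), (b + b'), ec, hbb, (qstr N h m + qstr N h' m'); split=> //.
by rewrite fractionD (fraction_expand _ _ hb _ e) (fraction_expand _ _ hb' _ e').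
Qed.

(** Multiplying a tensor by a monomial that clears all its denominators gives an
element of [N]; [term_eval d] computes its value in degree [d], and returns the
default [0] when [d] is too small for the left factor to reach it. *)
Definition term_eval d q (u : ptensor N (kloc k t) q) : N d :=
  match pselect (pt_ldeg u ⪯ d) with
  | left h => (subspace_val (pt_right u) : k) *: qstr N h (pt_left u)
  | right _ => 0
  end.

Definition tensor_eval d q (s : seq (ptensor N (kloc k t) q)) : N d :=
  \sum_(u <- s) term_eval d u.

(** Evaluation in degree [d] is not invariant under the balancing relation for
small [d], since one side may already take its default value; it is invariant
as soon as [d] is above [q + v] for a suitable [v] in [t].  This gives a map
from the tensor product to the direct limit of the [N (q + v)], and so detects
nonzero elements. *)
Lemma tensor_eval_eventually q (s s' : seq (ptensor N (kloc k t) q)) :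
  tens_eq s s' -> exists2 v, t v &
    forall d, q + v ⪯ d -> tensor_eval d s = tensor_eval d s'.
Proof.
have [t0 tD] := tM.
have termwise (x y : seq (ptensor N (kloc k t) q)) :
    (forall d, tensor_eval d x = tensor_eval d y) ->
    exists2 v, t v & forall d, q + v ⪯ d -> tensor_eval d x = tensor_eval d y.
  by exists 0.
have meet v v' d : t v -> t v' -> q + (v + v') ⪯ d -> q + v ⪯ d /\ q + v' ⪯ d.
  move=> tv tv' hd; split; apply: pole_trans hd.
    by rewrite /pole addrA [q + v + v']addrC addrK; exact: tQ.
  by rewrite /pole [v + v']addrC addrA [q + v' + v]addrC addrK; exact: tQ.
elim=> {s s'} [s|s s' _ [v tv E]|s s' s'' _ [v tv E] _ [v' tv' E']
  |s s' u u' _ [v tv E] _ [v' tv' E']|s s'|a b e n|a b e m m' n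
  |a b e m n n'|a b e c m n|a a' b b' h h' e e' m n].
- exact: termwise.
- by exists v => // d hd; rewrite E.
- exists (v + v'); first exact: tD.
  by move=> d /(meet _ _ _ tv tv')[hv hv']; rewrite E // E'.
- exists (v + v'); first exact: tD.
  move=> d /(meet _ _ _ tv tv')[hv hv'].
  by rewrite /tensor_eval !big_cat /=; congr (_ + _); [exact: E|exact: E'].
- by apply: termwise => d; rewrite /tensor_eval !big_cat /= addrC.
- apply: termwise => d; rewrite /tensor_eval big_seq1 big_nil /term_eval /=.
  by case: pselect => // h; rewrite linear0 scaler0.
- apply: termwise => d; rewrite /tensor_eval big_seq1 big_cons big_seq1 /term_eval /=.
  by case: pselect => [h|_]; rewrite ?addr0 // linearD scalerDr.
- apply: termwise => d; rewrite /tensor_eval big_seq1 big_cons big_seq1 /term_eval /=.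
  by case: pselect => [h|_]; rewrite ?addr0 // scalerDl.
- apply: termwise => d; rewrite /tensor_eval !big_seq1 /term_eval /=.
  by case: pselect => // h; rewrite linearZ scalerA mulrC.
- have [hb|nb] := pselect (loccone t b); last first.
    have n0 : subspace_val n = 0.
      by case: n => n /= /orP[/asboolP//|/eqP].
    apply: termwise => d; rewrite /tensor_eval !big_seq1 /term_eval /= n0.
    by case: pselect => h1; case: pselect => h2; rewrite ?scale0r.
  (* Since b + y = c + x is in the cone, so is d - a' for all d above q + y. *)
  have [c [z [pc /(zspan_submonoid tM)[x [y [tx ty ez]]] eb]]] := hb.
  exists y => // d hd.
  have ha' : a' ⪯ d.
    apply: pole_trans hd; have : poscone (c + x) by apply: posconeD => //; exact: tQ.
    by rewrite /pole -e {1}eb ez [a' + (c + _)]addrC addrAC addrK -addrA subrK.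
  have ha := pole_trans h ha'.
  rewrite /tensor_eval !big_seq1 /term_eval /=.
  case: pselect => // h1; case: pselect => // h2.
  by rewrite (qstr_comp _ _ h2).
Qed.

(** The kernel of localization consists of the elements killed by some element
of [t]: if [v] kills [x], then [x] is [x * v] over [v], so it vanishes; conversely
evaluate [x (x) 1] in a large enough degree [q + v]. *)
Lemma loc_map_eq0 q (x : N q) :
  loc_hom t N q x = 0 <->
  exists q' (h : q ⪯ q'), t (q' - q) /\ qstr N h x = 0.
Proof.
split=> [/tpiP/tensor_eval_eventually[v tv E]|[q' [h [tq' x0]]]].
  have h : q ⪯ q + v by rewrite /pole [q + v]addrC addrK; exact: tQ.
  exists (q + v), h; split; first by rewrite [q + v]addrC addrK.
  have := E _ (pole_refl _); rewrite /tensor_eval big_seq1 big_nil /term_eval /=.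
  case: pselect => // h1; rewrite scale1r => <-.
  by congr (qstr N _ x); exact: Prop_irrelevance.
have e : q' + - (q' - q) = q by rewrite opprB addrC subrK.
rewrite /= (loc_map_fraction x (loccone0 t)).
by rewrite -(fraction_expand h x (loccone0 t) (locconeN tq') _ e) x0 fraction0.
Qed.

End Fractions.

Section Coprimary.
Variables (k : fieldType) (Q : poabGroup) (N : qmod k Q).

(** A nonzero submodule of the localization contains a nonzero fraction [m / v];
multiplying it by [v] and then by the monomial that the second hypothesis
provides for [m] gives an element of the submodule that comes from [N].  It is
nonzero by the first hypothesis, and each face [s] not contained in [t] has
an element that kills it, so it vanishes in the localization along [s]. *)
Lemma coprimary_criterion (t : set Q) : is_face t ->
  (forall q q' (h : q ⪯ q') (x : N q), t (q' - q) -> qstr N h x = 0 -> x = 0) ->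
  (forall q (x : N q), x <> 0 -> exists q' (h : q ⪯ q'), qstr N h x <> 0 /\
    forall s, is_face s -> ~ s `<=` t ->
      exists q'' (h' : q' ⪯ q''), s (q'' - q') /\ qstr N h' (qstr N h x) = 0) ->
  coprimary N.
Proof.
move=> ft t_inj t_supp; have [tM tQ _] := ft.
have loc_inj q (x : N q) : loc_hom t N q x = 0 -> x = 0.
  by move=> /(loc_map_eq0 tM tQ)[q' [h [tq' /(t_inj _ _ _ _ tq')]]].
exists t; split=> // [q x y exy|S [q [z [zS z0]]]].
  by apply/eqP; rewrite -subr_eq0; apply/eqP/loc_inj; rewrite linearB exy subrr.
have [a [b [e [hb [m [tb ez]]]]]] := localization_fraction tM tQ z.
have m0 : m <> 0 by move=> m0; apply: z0; rewrite ez m0 fraction0.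
have [q' [h [hm0 hsupp]]] := t_supp _ _ m0.
have h' : q ⪯ q'.
  rewrite /pole -e opprD addrA; apply: posconeD => //; exact: tQ.
pose e'' := ptensor_str_deg q' e.
have e' : qstr (localization t N) h' z = loc_hom t N q' (qstr N h m).
  rewrite ez /= tens_strE /= (loc_map_fraction _ (loccone0 t)) /pt_str /=.
  have hq' : q' ⪯ a + (q' - q).
    by rewrite /pole [q' - q]addrC addrA addrK -e opprD addrA subrr add0r; exact: tQ.
  rewrite -(fraction_expand hq' _ (loccone0 t) hb (addr0 q') e'').
  by rewrite (qstr_comp _ _ (pole_shift a h')).
exists q', (loc_hom t N q' (qstr N h m)); split.
- by rewrite -e'; exact: sstr.
- apply/asboolP => s fs nst; have [q'' [h'' [sq'' hm]]] := hsupp _ fs nst.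
  have [sM sQ _] := fs; apply/(loc_map_eq0 sM sQ).
  by exists q'', h''; split=> //; rewrite -qhom_str hm linear0.
- by move=> /loc_inj.
Qed.

End Coprimary.

(** * Downsets *)

Section Downsets.
Variables (Q : poabGroup) (D : set Q).
Hypothesis hD : downset D.

(** The degrees of the submodule globally supported on [t] in the localization of
[k[D]] along [t]. *)
Definition local_support (t : set Q) : set Q :=
  [set g | (forall v, t v -> D (g + v)) /\
    forall s, is_face s -> ~ s `<=` t -> exists v w, [/\ t v, s w & ~ D (g + v + w)]].

(** The [t]-coprimary component of [D], cogenerated by the local support. *)
Definition coprimary_part (t : set Q) : set Q :=
  [set q | exists2 g, local_support t g & q ⪯ g].

Section Face.
Variables (t : set Q) (ft : is_face t).

Lemma coprimary_part_downset : downset (coprimary_part t).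
Proof. by move=> q q' le_qq' [g sg le_q'g]; exists g => //; exact: pole_trans le_q'g. Qed.

Lemma coprimary_part_sub : coprimary_part t `<=` D.
Proof.
move=> q [g [gD _] /hD]; apply; rewrite -[g]addr0; apply: gD.
by case: ft => -[].
Qed.

Lemma local_supportD g v : t v -> local_support t g -> local_support t (g + v).
Proof.
have [[_ tD] tQ _] := ft.
move=> tv [gD gs]; split=> [w tw|s fs nst]; first by rewrite -addrA; apply: gD; exact: tD.
have [x [y [tx sy nD]]] := gs s fs nst; exists x, y; split=> // /hD Dgv; apply: nD.
by apply: Dgv; rewrite /pole [g + v + x]addrAC [g + x + v + y]addrAC [_ + v]addrC addrK; exact: tQ.
Qed.

Lemma coprimary_partD q v : t v -> coprimary_part t q -> coprimary_part t (q + v).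
Proof.
move=> tv [g sg le_qg]; exists (g + v); first exact: local_supportD.
by rewrite /pole opprD addrACA subrr addr0.
Qed.

(** Some [g + v + w] is outside [D].  If [g + w] were in the coprimary part, so
would [g + w + v] be, by stability under translation by [t]. *)
Lemma local_support_exit g s : local_support t g -> is_face s -> ~ s `<=` t ->
  exists2 w, s w & ~ coprimary_part t (g + w).
Proof.
move=> [gD gs] fs nst; have [v [w [tv sw nD]]] := gs s fs nst; exists w => //.
by move=> /(coprimary_partD tv)/coprimary_part_sub; rewrite addrAC.
Qed.

End Face.

(** If [q + t + s] were inside [D] for a face [s] not contained in [t], the join
of [t] and [s] would be a strictly larger face along which [q] stays in [D]. *)
Lemma maximal_face_local_support q t : is_face t -> (forall v, t v -> D (q + v)) ->
  (forall s, is_face s -> (forall v, s v -> D (q + v)) -> t `<=` s -> s `<=` t) ->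
  local_support t q.
Proof.
move=> ft qtD tmax; split=> // s fs nst; apply: contrapT => nE; apply: nst.
apply: subset_trans (face_join_subr ft fs) _.
apply: tmax (face_join_face ft fs) _ (face_join_subl ft fs).
move=> v [pv [w [a [b [pw ta sb e]]]]]; apply: (@hD _ (q + a + b)).
  by rewrite /pole -[q + a + b]addrA -e addrA [q + v + w]addrC addrK.
by apply: contrapT => nD; apply: nE; exists a, b.
Qed.

End Downsets.

Lemma polyhedral_enum (Q : poabGroup) : polyhedral Q ->
  exists n (F : 'I_n -> set Q), (forall i, is_face (F i)) /\
    forall t, is_face t -> exists i, F i = t.
Proof.
move=> /finite_seqP[s es].
exists (size s), (tnth (in_tuple s)); split=> [i|t ft].
  suff : [set t | is_face t] (tnth (in_tuple s) i) by [].
  by rewrite es /= mem_tnth.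
have : [set t | is_face t] t by [].
by rewrite es /= => /(tnthP (in_tuple s))[i ->]; exists i.
Qed.

Lemma exists_maximal_set (T : Type) n (F : 'I_n -> set T) (P : set T -> Prop) i0 :
  P (F i0) -> exists2 i, P (F i) & forall j, P (F j) -> F i `<=` F j -> F j `<=` F i.
Proof.
(* Strict inclusion strictly increases the number of members that lie below,
   so a member maximizing that number is maximal. *)
move=> Pi0; pose below i := [set j | `[< F j `<=` F i >]]%SET.
have [i /asboolP Pi imax] :=
  @arg_maxnP _ i0 (fun i => `[< P (F i) >]) (fun i => #|below i|) (introT (asboolP _) Pi0).
exists i => // j /asboolP /imax card_ji ij.
have sub : below i \subset below j.
  apply/fintype.subsetP => l; rewrite !finset.in_set => /asboolP li; apply/asboolP.
  exact: subset_trans li ij.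
have : j \in below j by rewrite finset.in_set; apply/asboolP.
have /eqP <- : below i == below j by rewrite eqEcard sub.
by rewrite finset.in_set => /asboolP.
Qed.

Lemma coprimary_part_cover (Q : poabGroup) (D : set Q) q :
  polyhedral Q -> downset D -> D q ->
  exists2 t, is_face t & coprimary_part D t q.
Proof.
move=> /polyhedral_enum[n [F [Fface Fsurj]]] hD Dq.
have [i0 ei0] := Fsurj _ (face0 Q).
have [|i qi imax] := @exists_maximal_set _ _ F (fun t => forall v, t v -> D (q + v)) i0.
  by rewrite ei0 => _ ->; rewrite addr0.
exists (F i) => //; exists q; last exact: pole_refl.
apply: maximal_face_local_support => // s fs; have [j <-] := Fsurj _ fs.
exact: imax.
Qed.

(** * Decomposing a downset-finite module *)

Section Component.
Variables (k : fieldType) (Q : poabGroup) (M : qmod k Q).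
Variables (D : set Q) (hD : downset D) (f : qhom M (downset_mod k hD)).

Lemma downset_mod_out q (y : downset_mod k hD q) : ~ D q -> y = 0.
Proof.
move=> nDq; rewrite -[y]qrepK -(linear0 (lin (@qpi_linear _ _ _))).
by apply/qpiP/orP; left; apply/asboolP.
Qed.

Lemma downset_mod_str_inj q q' (h : q ⪯ q') (y : downset_mod k hD q) :
  D q' -> qstr (downset_mod k hD) h y = 0 -> y = 0.
Proof.
move=> Dq'; rewrite -[y]qrepK /= quot_strE.
rewrite -(linear0 (lin (@qpi_linear _ _ _))) => /qpiP/orP[/asboolP//|].
by rewrite subr0 /= => /eqP ->; exact: (linear0 (lin (@qpi_linear _ _ _))).
Qed.

Variable t : set Q.

(** The kernel of the composite of [f] with the quotient map from [k[D]] to the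
downset module of the coprimary part; the latter map is the identity in the
degrees of the coprimary part and zero elsewhere. *)
Definition component_pred q : {pred M q} :=
  fun x => `[< coprimary_part D t q -> f q x = 0 >].

Lemma component_closed q : submod_closed (@component_pred q).
Proof.
split=> [|a x y]; first by apply/asboolP => _; rewrite linear0.
move=> /asboolP x0 /asboolP y0; apply/asboolP => Pq.
by rewrite linearP x0 // y0 // scaler0 addr0.
Qed.

HB.instance Definition _ q :=
  GRing.isSubmodClosed.Build k (M q) (@component_pred q)
    (GRing.submod_closed_semi (@component_closed q)).

Lemma component_str q q' (h : q ⪯ q') (x : M q) :
  x \in @component_pred q -> qstr M h x \in @component_pred q'.
Proof.
move=> /asboolP x0; apply/asboolP => Pq'.
by rewrite qhom_str x0 ?linear0 //; exact: coprimary_part_downset Pq'.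
Qed.

Definition component : submod M :=
  @Submod k Q M (fun q => @component_pred q) component_str.

Lemma component_quot_eq0 q (x : M q) :
  quot_proj component q x = 0 <-> (coprimary_part D t q -> f q x = 0).
Proof.
rewrite -(linear0 (quot_proj component q)); split.
  by move=> /qpiP; rewrite subr0 => /asboolP.
by move=> x0; apply/qpiP; rewrite subr0; apply/asboolP.
Qed.

Lemma component_coprimary : is_face t -> coprimary (quot_mod component).
Proof.
move=> ft; apply: (coprimary_criterion ft) => [q q' h y|q y];
  rewrite -[y]qrepK; set x := qrep y; rewrite -[qpi _ x]/(quot_proj component q x).
- rewrite -qhom_str => tv /component_quot_eq0 hx0; apply/component_quot_eq0 => Pq.
  have Pq' : coprimary_part D t q'.
    by rewrite -(subrK q q') addrC; exact: coprimary_partD.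
  have := hx0 Pq'; rewrite qhom_str; apply: downset_mod_str_inj.
  exact: coprimary_part_sub Pq'.
- move=> /component_quot_eq0/not_implyP[[g sg le_qg] fx0].
  have Pg : coprimary_part D t g by exists g => //; exact: pole_refl.
  exists g, le_qg; rewrite -qhom_str; split.
    move=> /component_quot_eq0/(_ Pg); rewrite qhom_str => /downset_mod_str_inj fx.
    by apply: fx0; apply: fx; exact: coprimary_part_sub Pg.
  move=> s fs nst; have [w sw nP] := local_support_exit hD ft sg fs nst.
  have [_ sQ _] := fs.
  have h : g ⪯ g + w by rewrite /pole [g + w]addrC addrK; exact: sQ.
  exists (g + w), h; split; first by rewrite [g + w]addrC addrK.
  by rewrite -qhom_str; apply/component_quot_eq0.
Qed.

End Component.

Section Coordinates.
Variables (k : fieldType) (Q : poabGroup) (J : finType) (E : J -> qmod k Q).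
Variables (M : qmod k Q) (f : qhom M (dsum_mod E)) (j : J).

Definition coordinate q (x : M q) : E j q := f q x j.

Lemma coordinate_linear q : linear (@coordinate q).
Proof. by move=> a x y; rewrite /coordinate linearP. Qed.

Lemma coordinate_str q q' (h : q ⪯ q') (x : M q) :
  lin (@coordinate_linear q') (qstr M h x) = qstr (E j) h (lin (@coordinate_linear q) x).
Proof. by rewrite /= /coordinate qhom_str. Qed.

Definition coordinate_hom : qhom M (E j) := QHom coordinate_str.

End Coordinates.

Theorem theorem3p32 (Q : poabGroup) (k : fieldType) (M : qmod k Q) :
  polyhedral Q -> downset_finite M ->
  exists (r : nat) (S : 'I_r -> submod M), primary_decomposition S.
Proof.
move=> polyQ [J [D [hD [f finj]]]].
have [n [F [Fface Fsurj]]] := polyhedral_enum polyQ.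
pose S (p : J * 'I_n) := component (coordinate_hom f p.1) (F p.2).
exists #|{: J * 'I_n}|, (fun i => S (enum_val i)); split.
  by move=> i; apply: component_coprimary.
move=> q x y exy; apply: finj; apply: functional_extensionality_dep => j.
apply/eqP; rewrite -subr_eq0; apply/eqP.
rewrite -[LHS]/(coordinate_hom f j q x - coordinate_hom f j q y) -linearB.
have [Dq|] := pselect (D j q); last exact: downset_mod_out.
have [t ft Pq] := coprimary_part_cover polyQ (hD j) Dq.
have [i ei] := Fsurj t ft.
suff : quot_proj (S (j, i)) q (x - y) = 0.
  by move=> /component_quot_eq0; rewrite /= ei => /(_ Pq).
rewrite linearB; apply/eqP; rewrite subr_eq0; apply/eqP.
have := f_equal (fun z => z (enum_rank (j, i))) exy.
by rewrite /= /dsum_map enum_rankK.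
Qed.
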